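(* For every real number $x\in(1,2)$ and every integer $N\ge2$, there exists a function $$\varepsilon_{x,N}:\mathcal{D}_{N-2}\longrightarrow\{0,1,-1\}$$ such that $$[q^N]\,[x]_q=\sum_{T\in\mathcal{D}_{N-2}}\varepsilon_{x,N}(T).$$
   Context: $[q^N]A$ denotes the coefficient of $q^N$ in a formal power series $A\in\mathbb{Z}[[q]]$. The golden class $\mathcal{D}$. $\mathcal{D}$ is the class of ordered rooted trees freely generated from the single one-vertex tree $E$ by two unary constructors $P_1,P_2$ and one binary constructor $Q$ (with ordered left and right subtrees); that is, $\mathcal{D}=\{E\}\sqcup P_1(\mathcal{D})\sqcup P_2(\mathcal{D})\sqcup Q(\mathcal{D},\mathcal{D})$. Degrees: $\deg E=0$, $\deg P_1(T)=1+\deg T$, $\deg P_2(T)=2+\deg T$, $\deg Q(T_1,T_2)=3+\deg T_1+\deg T_2$. Put $\mathcal{D}_n=\{T\in\mathcal{D}:\deg T=n\}$ (a finite set). For an integer $a$ put $[a]_q=\frac{1-q^a}{1-q}$ (so $[a]_q=1+q+\cdots+q^{a-1}$ for $a\ge1$, and $[0]_q=0$). Definition of the $q$-real $[x]_q$. Every real $x$ has a unique negative (Hirzebruch) continued fraction expansion with $a_1\in\mathbb{Z}$ and $a_i\ge2$ integers for $i\ge2$: if $x$ is rational it is finite, $x=a_1-\cfrac{1}{a_2-\cfrac{1}{\ddots-\cfrac{1}{a_k}}}$, written $x=[\![a_1,\dots,a_k]\!]$, and if $x$ is irrational it is infinite, $x=[\![a_1,a_2,a_3,\dots]\!]$. For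 rational $x=[\![a_1,\dots,a_k]\!]$ one sets $$[x]_q=[a_1]_q-\cfrac{q^{a_1-1}}{[a_2]_q-\cfrac{q^{a_2-1}}{\ddots-\cfrac{q^{a_{k-1}-1}}{[a_k]_q}}},$$ a rational function of $q$, identified with its Laurent expansion at $q=0$. For irrational $x=[\![a_1,a_2,\dots]\!]$, each coefficient of the Laurent expansions at $q=0$ of $\big[[\![a_1,\dots,a_k]\!]\big]_q$ stabilizes as $k\to\infty$ (known stabilization theorem), and $[x]_q\in\mathbb{Z}((q))$ is defined as the resulting limit. For $x\ge0$ one has $[x]_q\in\mathbb{Z}[[q]]$. *)

(* Defs.v *)
From HB Require Import structures.
From mathcomp Require Import all_boot all_order all_algebra fraction.
From mathcomp Require Import all_classical all_reals topology normedtype sequences.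
From mathcomp Require Import zify ring lra.

Set Implicit Arguments.
Unset Strict Implicit.
Unset Printing Implicit Defensive.

Import Order.TTheory GRing.Theory Num.Theory.
Import numFieldNormedType.Exports.

Local Open Scope ring_scope.
Local Open Scope classical_set_scope.

Inductive golden : Type :=
| E
| P1 of golden
| P2 of golden
| Q of golden & golden.

Fixpoint deg (T : golden) : nat :=
  match T with
  | E => 0
  | P1 T1 => 1 + deg T1
  | P2 T1 => 2 + deg T1
  | Q T1 T2 => 3 + deg T1 + deg T2
  end.

Fixpoint golden_encode (T : golden) : GenTree.tree unit :=
  match T with
  | E => GenTree.Leaf tt
  | P1 T1 => GenTree.Node 1 [:: golden_encode T1]
  | P2 T1 => GenTree.Node 2 [:: golden_encode T1]
  | Q T1 T2 => GenTree.Node 3 [:: golden_encode T1; golden_encode T2]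
  end.

Fixpoint golden_decode (t : GenTree.tree unit) : golden :=
  match t with
  | GenTree.Node 1 [:: t1] => P1 (golden_decode t1)
  | GenTree.Node 2 [:: t1] => P2 (golden_decode t1)
  | GenTree.Node 3 [:: t1; t2] => Q (golden_decode t1) (golden_decode t2)
  | _ => E
  end.

Lemma golden_encodeK : cancel golden_encode golden_decode.
Proof. by elim=> //= [T -> //|T -> //|T -> T' ->]. Qed.

HB.instance Definition _ := Countable.copy golden (can_type golden_encodeK).

(* All trees of height at most [h]; a tree of degree [n] has height at most
   [n], so that only finitely many trees have degree [n]. *)
Fixpoint golden_upto (h : nat) : seq golden :=
  if h is h'.+1 then
    let s := golden_upto h' in
    E :: map P1 s ++ map P2 s ++ [seq Q T1 T2 | T1 <- s, T2 <- s]
  else [:: E].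

Lemma mem_golden_upto T h : (deg T <= h)%N -> T \in golden_upto h.
Proof.
elim: h T => [|h IHh] [|T|T|T T'] //= degT; rewrite inE /= !mem_cat.
- by rewrite map_f // IHh.
- by rewrite [in X in _ || X]map_f ?orbT // IHh //; lia.
- apply/orP; right; apply/orP; right.
  by apply: allpairs_f; apply: IHh; lia.
Qed.

Definition golden_deg (n : nat) := {T : golden | deg T == n}.

HB.instance Definition _ n := Countable.on (golden_deg n).

Definition golden_deg_enum n : seq (golden_deg n) :=
  undup (pmap insub (golden_upto n)).

Lemma golden_deg_enumP n : Finite.axiom (golden_deg_enum n).
Proof.
apply: Finite.uniq_enumP; first exact: undup_uniq.
move=> T; rewrite mem_undup mem_pmap_sub mem_golden_upto //.
by rewrite (eqP (valP T)).
Qed.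

HB.instance Definition _ n := isFinite.Build (golden_deg n) (@golden_deg_enumP n).

(* [A n] is the coefficient of [q^n] in [A]. *)
Record laurent := Laurent {
  coefL :> int -> int;
  laurent_bounded : exists m : int, forall n, n < m -> coefL n = 0
}.

Definition ratfun : Type := {fraction {poly int}}.

Local Notation tofrac := (@FracField.tofrac {poly int}).

Definition q : ratfun := tofrac 'X.

Definition coefz (P : {poly int}) (n : int) : int :=
  if n is Posz k then P`_k else 0.

(* [A] is the Laurent expansion at [q = 0] of the rational function
   [F = N / D]: the products [D * A] and [N] agree in [Z((q))]. *)
Definition laurent_expansion (F : ratfun) (A : laurent) : Prop :=
  exists N D : {poly int},
    [/\ D != 0, F = tofrac N / tofrac D
      & forall n : int,
          \sum_(j < size D) D`_j * A (n - j%:Z) = coefz N n].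

Fixpoint hcf {R : realType} (a : int) (s : seq int) : R :=
  if s is b :: s' then a%:~R - (hcf b s')^-1 else a%:~R.

Definition q_int (a : int) : ratfun := (1 - q ^ a) / (1 - q).

Fixpoint q_hcf (a : int) (s : seq int) : ratfun :=
  if s is b :: s' then q_int a - q ^ (a - 1) / q_hcf b s' else q_int a.

(* [a 0] is the first entry [a_1], so that
   [hcf (a 0) (digits a k)] is the convergent with [k + 1] entries. *)
Definition digits (a : nat -> int) (k : nat) : seq int :=
  mkseq (fun i => a i.+1) k.

Definition is_qreal {R : realType} (x : R) (A : laurent) : Prop :=
  (rational x /\
   exists (a : int) (s : seq int),
     [/\ all (fun b : int => 2 <= b) s, x = hcf a s
       & laurent_expansion (q_hcf a s) A])
  \/
  (irrational x /\
   exists (a : nat -> int) (B : nat -> laurent),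
     [/\ forall i, 2 <= a i.+1,
         (fun k => hcf (a 0) (digits a k) : R) @ \oo --> x,
         forall k, laurent_expansion (q_hcf (a 0) (digits a k)) (B k)
       & forall n : int, \forall k \near \oo, B k n = A n]).

(* For [s = b :: s'] with entries at least 2, [q_hcf b s'] is the quotient of
   the two components. *)
Fixpoint pd (s : seq int) : {poly int} * {poly int} :=
  if s is b :: s' then
    ((\poly_(i < `|b|) 1) * (pd s').1 - 'X^(`|b|.-1) * (pd s').2, (pd s').1)
  else (1, 0).

Lemma pdE b s : pd (b :: s) =
  ((\poly_(i < `|b|) 1) * (pd s).1 - 'X^(`|b|.-1) * (pd s).2, (pd s).1).
Proof. by []. Qed.

Arguments pd : simpl never.

Lemma pd_coef0 s : all (fun b : int => 2 <= b) s -> (pd s).1`_0 = 1.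
Proof.
elim: s => [|b s IHs]; first by rewrite coef1.
move=> /= /andP[b2 /IHs P0]; rewrite ?pdE /=.
have -> : `|b|%N = `|b|.-2.+2 by lia.
by rewrite coefB !coef0M coef_poly coefXn P0 /=; lia.
Qed.

Lemma pd_neq0 s : all (fun b : int => 2 <= b) s -> (pd s).1 != 0.
Proof. by move=> /pd_coef0 P0; apply/eqP => Pz; move: P0; rewrite Pz coef0. Qed.

Lemma q_neq0 : q != 0.
Proof. by rewrite tofrac_eq0 polyX_eq0. Qed.

Lemma oneBX_neq0 : 1 - 'X != 0 :> {poly int}.
Proof. by rewrite -oppr_eq0 opprB -polyC1 polyXsubC_eq0. Qed.

Lemma oneBq_neq0 : 1 - q != 0.
Proof. by rewrite -tofrac1 -tofracB tofrac_eq0 oneBX_neq0. Qed.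

Lemma q_int_tofrac (b : int) : 0 <= b -> q_int b = tofrac (\poly_(i < `|b|) 1).
Proof.
case: b => // n _; apply: (canLR (mulfK oneBq_neq0)).
rewrite -exprnP -tofrac1 /q -tofracXn -!tofracB -tofracM; congr tofrac.
rewrite poly_def /=; under eq_bigr do rewrite scale1r.
by rewrite -opprB subrX1 -mulNr opprB mulrC.
Qed.

Lemma q_expz (n : int) : 0 <= n -> q ^ n = tofrac 'X^`|n|.
Proof. by case: n => // n _; rewrite tofracXn. Qed.

Lemma q_hcf_pd (b : int) (s : seq int) : all (fun b : int => 2 <= b) (b :: s) ->
  q_hcf b s = tofrac (pd (b :: s)).1 / tofrac (pd (b :: s)).2.
Proof.
elim: s b => [|c s IHs] b /andP[b2 s2].
  by rewrite pdE /= q_int_tofrac ?mulr0 ?subr0 ?tofrac1 ?divr1 ?mulr1 //; lia.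
rewrite -[is_true _]/(is_true (all _ (c :: s))) in s2.
rewrite [LHS]/= (IHs c s2) [pd [:: b, c & s]]pdE.
have := pd_neq0 s2; case: (pd (c :: s)) => P D /= Pn0.
rewrite q_int_tofrac ?q_expz; [|lia|lia].
rewrite invf_div tofracB !tofracM mulrBl mulfK ?tofrac_eq0 // mulrA.
by have -> : `|b - 1|%N = `|b|.-1 by lia.
Qed.

Definition congX (M : nat) (A B : {poly int}) : Prop :=
  exists C, A = B + 'X^M * C.

Lemma congX_coef M (A B : {poly int}) n : congX M A B -> (n < M)%N -> A`_n = B`_n.
Proof. by case=> C -> nM; rewrite coefD coefXnM nM addr0. Qed.

Lemma congX_le M N (A B : {poly int}) : (N <= M)%N -> congX M A B -> congX N A B.
Proof.
move=> NM [C ->]; exists ('X^(M - N) * C).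
by rewrite mulrA -exprD subnKC.
Qed.

(* The inverse of [D] modulo [X^(n+1)] when [D] has constant term 1. *)
Definition uinv (n : nat) (D : {poly int}) : {poly int} :=
  \sum_(i < n.+1) (1 - D) ^+ i.

Lemma uinvP n (D : {poly int}) : D`_0 = 1 -> congX n.+1 (D * uinv n D) 1.
Proof.
move=> D0; have : root (1 - D) 0 by rewrite rootE horner_coef0 coefB D0 coef1 subrr.
move=> /factor_theorem[S]; rewrite polyC0 subr0 => DS; exists (- S ^+ n.+1).
have H : (1 - D) ^+ n.+1 - 1 = (1 - D - 1) * uinv n D by exact: subrX1.
have -> : D * uinv n D = - ((1 - D - 1) * uinv n D) by ring.
by rewrite -H DS exprMn; ring.
Qed.

Lemma congX_quo M (P1 D1 U1 P2 D2 U2 : {poly int}) :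
  congX M (D1 * U1) 1 -> congX M (D2 * U2) 1 -> congX M (P1 * D2) (P2 * D1) ->
  congX M (P1 * U1) (P2 * U2).
Proof.
move=> [C1 E1] [C2 E2] [C3 E3].
exists (P2 * U2 * C1 + C3 * U1 * U2 - P1 * U1 * C2).
have F1 : P1 * U1 * (D2 * U2) = (P1 * D2) * (U1 * U2) by ring.
have F2 : P2 * D1 * (U1 * U2) = P2 * U2 * (D1 * U1) by ring.
move: F1; rewrite E3 E2 mulrDl F2 E1 => F1.
transitivity (P1 * U1 * (1 + 'X^M * C2) - P1 * U1 * ('X^M * C2)); first by ring.
by rewrite F1; ring.
Qed.

Definition ser (P D : {poly int}) (n : nat) : int := (P * uinv n D)`_n.

Lemma ser_congX M (P1 D1 P2 D2 : {poly int}) k1 k2 n : D1`_0 = 1 -> D2`_0 = 1 ->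
  congX M (P1 * D2) (P2 * D1) -> (n < M)%N -> (n <= k1)%N -> (n <= k2)%N ->
  (P1 * uinv k1 D1)`_n = (P2 * uinv k2 D2)`_n.
Proof.
move=> D10 D20 H nM n1 n2; apply: (@congX_coef n.+1) => //.
apply: congX_quo; last exact: congX_le H.
- by apply: congX_le (uinvP k1 D10).
- by apply: congX_le (uinvP k2 D20).
Qed.

Lemma sum_size_widen (D : {poly int}) (f : nat -> int) N : (size D <= N)%N ->
  \sum_(j < size D) D`_j * f j = \sum_(j < N) D`_j * f j.
Proof.
move=> DN; rewrite (big_ord_widen _ (fun j => D`_j * f j) DN) big_mkcond.
by apply: eq_bigr => j _; case: ltnP => // /leq_sizeP->; rewrite ?mul0r.
Qed.

Lemma ser_mul (P D : {poly int}) n : D`_0 = 1 ->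
  \sum_(j < size D) D`_j * (if (j <= n)%N then ser P D (n - j) else 0) = P`_n.
Proof.
move=> D0; have -> : P`_n = (D * (P * uinv n D))`_n.
  apply: (@congX_coef n.+1) => //; have [C E] := uinvP n D0.
  exists (- (P * C)); rewrite mulrCA E; ring.
rewrite (@sum_size_widen _ (fun j => if (j <= n)%N then ser P D (n - j) else 0)
           (size D + n.+1)) ?leq_addr // coefM.
rewrite (big_ord_widen _ (fun j => D`_j * (P * uinv n D)`_(n - j))
           (leq_addl (size D) n.+1)) [RHS]big_mkcond /=.
apply: eq_bigr => j _; rewrite ltnS; case: leqP => jn; last by rewrite mulr0.
by congr (_ * _); apply: (@ser_congX n.+1) => //; [exists 0; ring|lia..].
Qed.

Definition serz (m : nat) (P D : {poly int}) (n : int) : int :=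
  if n + m%:Z is Posz k then ser P D k else 0.

Lemma serz_bounded m P D : exists b : int, forall n, n < b -> serz m P D n = 0.
Proof. by exists (- m%:Z) => n; rewrite /serz; case E: (n + m%:Z) => //; lia. Qed.

Definition serL m P D : laurent := Laurent (serz_bounded m P D).

Lemma serL_expansion m (P D : {poly int}) : D`_0 = 1 ->
  laurent_expansion (tofrac P / tofrac ('X^m * D)) (serL m P D).
Proof.
move=> D0; have Dn0 : D != 0 by apply/eqP => E; move: D0; rewrite E coef0.
exists P, ('X^m * D); split=> // [|n]; first by rewrite mulf_neq0 // -size_poly_eq0 size_polyXn.
rewrite (@sum_size_widen _ (fun j => serz m P D (n - j%:Z)) (m + size D)); last first.
  by rewrite mulrC size_mulXn // addnC.
rewrite big_split_ord /= big1 ?add0r => [|j _]; last first.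
  by rewrite coefXnM ltn_ord mul0r.
under eq_bigr => j _ do rewrite coefXnM ltnNge leq_addr /= addKn.
case: n => n /=.
  rewrite -(ser_mul P n D0); apply: eq_bigr => j _; congr (_ * _).
  move: (nat_of_ord j) => {}j; rewrite /serz; case: leqP => jn.
    by have -> : n%:Z - (m + j)%:Z + m%:Z = (n - j)%N%:Z by lia.
  by case E: (n%:Z - (m + j)%:Z + m%:Z) => //; lia.
rewrite big1 // => j _; move: (D`_j) (nat_of_ord j) => d {}j; rewrite /serz.
by case E: (Negz n - (m + j)%:Z + m%:Z) => //; rewrite ?mulr0 //; lia.
Qed.

Definition qnum (a : int) (s : seq int) : {poly int} :=
  ('X^(`|a|.+1) - 'X^`|a + `|a|.+1%:Z|) * (pd s).1
  - 'X^`|a + `|a|%:Z| * (1 - 'X) * (pd s).2.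

Definition qden (s : seq int) : {poly int} := (1 - 'X) * (pd s).1.

Lemma qden_coef0 s : all (fun b : int => 2 <= b) s -> (qden s)`_0 = 1.
Proof. by move=> s2; rewrite coef0M pd_coef0 // coefB coef1 coefX. Qed.

Lemma hcf_field (F : fieldType) (u v w o P D : F) :
  u != 0 -> o != 0 -> P != 0 ->
  (1 - w / u) / o - v / u * (D / P) = ((u - w) * P - v * o * D) / (u * (o * P)).
Proof. by move=> un on Pn; field; rewrite un on Pn. Qed.

Lemma q_hcf_frac a s : all (fun b : int => 2 <= b) s ->
  q_hcf a s = tofrac (qnum a s) / tofrac ('X^(`|a|.+1) * qden s).
Proof.
move=> s2.
have -> : q_hcf a s =
    q_int a - q ^ (a - 1) * (tofrac (pd s).2 / tofrac (pd s).1).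
  case: s s2 => [|b s] s2; first by rewrite /= tofrac0 mul0r mulr0 subr0.
  by rewrite [LHS]/= q_hcf_pd // invf_div.
have := pd_neq0 s2; rewrite /qnum /qden /q_int.
case: (pd s) => P D /= Pn0.
have qE n : q ^+ n != 0 by rewrite expf_neq0 // q_neq0.
have qa : q ^ a = q ^ (a + `|a|.+1%:Z) / q ^+ `|a|.+1.
  by rewrite expfzDr ?q_neq0 // -exprnP mulfK ?qE.
have qa1 : q ^ (a - 1) = q ^ (a + `|a|%:Z) / q ^+ `|a|.+1.
  rewrite (_ : a + `|a|%:Z = a - 1 + `|a|.+1%:Z); last by lia.
  by rewrite [q ^ (a - 1 + _)]expfzDr ?q_neq0 // -exprnP mulfK ?qE.
rewrite qa qa1 !q_expz; [|lia|lia].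
rewrite !(tofracM, tofracB) tofrac1 [tofrac 'X^(`|a|.+1)]tofracXn -/q.
have Pn : tofrac P != 0 by rewrite tofrac_eq0.
exact: (hcf_field _ _ _ (qE _) oneBq_neq0 Pn).
Qed.

Lemma pd_det s t : all (fun b : int => 2 <= b) (s ++ t) ->
  congX (size s) ((pd s).2 * (pd (s ++ t)).1) ((pd (s ++ t)).2 * (pd s).1).
Proof.
elim: s => [|b s IHs].
  by move=> _; exists (- (pd t).2); rewrite expr0 /pd /=; ring.
move=> /= /andP[b2 /IHs]; rewrite ?pdE /=; case: (pd s) => P D; case: (pd (s ++ t)) => P' D' /= [C E].
exists ('X^(`|b|.-2) * C).
have -> : `|b|.-1 = (`|b|.-2).+1 by lia.
rewrite exprS exprS; set e := 'X^(`|b|.-2); set B := \poly_(i < _) 1.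
have -> : P * (B * P' - 'X * e * D') =
  P' * (B * P - 'X * e * D) + 'X * e * (D * P' - D' * P) by ring.
by rewrite E; ring.
Qed.

Lemma qnum_qden_congX a s t : all (fun b : int => 2 <= b) (s ++ t) ->
  congX (size s) (qnum a s * qden (s ++ t)) (qnum a (s ++ t) * qden s).
Proof.
move=> /pd_det; rewrite /qnum /qden.
case: (pd s) => P D; case: (pd (s ++ t)) => P' D' /= [C E].
set u := 'X^_ - 'X^_; set v := 'X^`|a + `|a|%:Z|; set w := 1 - 'X.
exists (- (v * w * w * C)).
have -> : (u * P - v * w * D) * (w * P') =
  (u * P' - v * w * D') * (w * P) - v * w * w * (D * P' - D' * P) by ring.
by rewrite E; ring.
Qed.

Definition serA a s : laurent := serL `|a|.+1 (qnum a s) (qden s).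

Lemma serA_expansion a s : all (fun b : int => 2 <= b) s ->
  laurent_expansion (q_hcf a s) (serA a s).
Proof. by move=> s2; rewrite q_hcf_frac //; apply/serL_expansion/qden_coef0. Qed.

Lemma serA_stable a s t (n : int) : all (fun b : int => 2 <= b) (s ++ t) ->
  n + `|a|.+1%:Z < (size s)%:Z -> serA a s n = serA a (s ++ t) n.
Proof.
move=> st2 ns; have := st2; rewrite all_cat => /andP[s2 _].
rewrite /= /serz; case nE : (n + `|a|.+1%:Z) => [k|//].
have ks : (k < size s)%N by lia.
by apply: (ser_congX _ _ (qnum_qden_congX a st2) ks) => //; exact: qden_coef0.
Qed.

Section HirzebruchExpansion.
Context {R : realType}.

Lemma hcf_rational (d : nat) (n : int) : (0 < d)%N ->
  exists (a : int) (s : seq int),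
    [/\ all (fun b : int => 2 <= b) s,
        n%:~R / d%:R = hcf a s :> R & n%:~R / d%:R <= a%:~R :> R].
Proof.
have [m] := ubnP d; elim: m d n => // m IHm d n dm d0.
pose c := (- n %/ d%:Z)%Z; pose r := `|(- n %% d%:Z)%Z|%N.
have dz : (d%:Z != 0) by lia.
have rE : (- n %% d%:Z)%Z = r%:Z by rewrite gez0_abs // modz_ge0.
have nE : n = - c * d%:Z - r%:Z.
  by apply: oppr_inj; rewrite {1}(divz_eq (- n) d%:Z) rE -/c; ring.
have rd : (r < d)%N.
  have d0z : (0 < d%:Z) by lia.
  by have := ltz_pmod (- n) d0z; rewrite rE; lia.
have dR : d%:R != 0 :> R by rewrite pnatr_eq0 -lt0n.
have xE : n%:~R / d%:R = (- c)%:~R - r%:R / d%:R :> R.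
  by rewrite nE rmorphB rmorphM /= mulrBl mulfK.
exists (- c); have [r0|r0] := posnP r.
  by exists [::]; rewrite xE r0 mul0r subr0.
have [|b [s [s2 yE yb]]] := IHm r d%:Z _ r0; first by apply: leq_trans rd _.
exists (b :: s); split.
- rewrite /= s2 andbT.
  have : (1 : R) < b%:~R.
    by apply: lt_le_trans yb; rewrite ltr_pdivlMr ?ltr0n // mul1r ltr_nat.
  by rewrite (_ : 1 = 1%:~R) // ltr_int; lia.
- by rewrite xE /= -yE invf_div.
- by rewrite xE gerBl divr_ge0 // ler0n.
Qed.

Context (x : R) (x_irrational : irrational x).

Fixpoint cquo (k : nat) : R :=
  if k is k'.+1 then ((Num.ceil (cquo k'))%:~R - cquo k')^-1 else x.

Definition cdigit (k : nat) : int := Num.ceil (cquo k).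

Lemma cquo_irrational k : irrational (cquo k).
Proof.
elim: k => // k IHk [r _ rE]; apply: IHk.
exists ((cdigit k)%:~R - r^-1) => //.
by rewrite rmorphB /= fmorphV /= rE ratr_int /= invrK /cdigit; ring.
Qed.

Lemma cquo_itv k : (cdigit k)%:~R - 1 < cquo k < (cdigit k)%:~R.
Proof.
have /andP[cl cr] := ceil_itv (cquo k).
rewrite -/(cdigit k) rmorphB /= in cl; rewrite cl /= lt_neqAle cr andbT.
apply/eqP => cE; apply: (@cquo_irrational k).
by exists (cdigit k)%:~R; rewrite ?ratr_int.
Qed.

Lemma cquoS_gt1 k : 1 < cquo k.+1.
Proof. by have /andP[? ?] := cquo_itv k; rewrite /= -/(cdigit k) invf_gt1; lra. Qed.

Lemma cdigitS_ge2 k : 2 <= cdigit k.+1.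
Proof.
have := lt_trans (cquoS_gt1 k) (proj2 (andP (cquo_itv k.+1))).
by rewrite (_ : 1 = 1%:~R) // ltr_int; lia.
Qed.

Fixpoint cconv (k m : nat) : R :=
  if m is m'.+1 then (cdigit k)%:~R - (cconv k.+1 m')^-1 else (cdigit k)%:~R.

Lemma cconvE k m : hcf (cdigit k) (digits (fun i => cdigit (k + i)) m) = cconv k m.
Proof.
elim: m k => // m IHm k.
have -> : digits (fun i => cdigit (k + i)) m.+1 =
    cdigit k.+1 :: digits (fun i => cdigit (k.+1 + i)) m.
  rewrite /digits /mkseq /= addn1 (iotaDl 1 0) -map_comp; congr cons.
  by apply: eq_map => i /=; congr cdigit; lia.
by rewrite /= IHm.
Qed.

Lemma cconv_ge k m : m.+2%:R <= m.+1%:R * cconv k.+1 m.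
Proof.
elim: m k => [|m IHm] k /=.
  by rewrite mul1r (_ : 2 = 2%:~R) // ler_int cdigitS_ge2.
have d2 : (2 : R) <= (cdigit k.+1)%:~R by rewrite (_ : 2 = 2%:~R) // ler_int cdigitS_ge2.
have := IHm k.+1; set e := cconv _ _ => eE.
have e0 : 0 < e by rewrite -(pmulr_rgt0 _ (ltr0Sn R m)); apply: lt_le_trans eE; rewrite ltr0n.
have : m.+2%:R * e^-1 <= m.+1%:R by rewrite ler_pdivrMr.
have : (0 : R) < m.+2%:R by rewrite ltr0n.
by rewrite -[m.+3%:R]natr1 -[m.+2%:R]natr1; move: (m.+1%:R : R) => M ? ?; nra.
Qed.

Lemma cconv_dist k m : 0 <= cconv k m - cquo k /\
  m.+1%:R * (cconv k m - cquo k) <= 1.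
Proof.
elim: m k => [|m IHm] k /=; first by have /andP[? ?] := cquo_itv k; split; lra.
have y1 := cquoS_gt1 k; have eE := cconv_ge k m.
have [] := IHm k.+1; have cE : cquo k = (cdigit k)%:~R - (cquo k.+1)^-1.
  by rewrite /= invrK -/(cdigit k); ring.
rewrite cE; move: (cconv _ _) (cquo k.+1) y1 eE => e y y1 eE ye ey.
have y0 : 0 < y by lra.
have e0 : 0 < e by lra.
have -> : (cdigit k)%:~R - e^-1 - ((cdigit k)%:~R - y^-1) = (e - y) / (y * e).
  by field; rewrite !gt_eqF.
split; first by rewrite divr_ge0 // mulr_ge0 ?ltW.
rewrite mulrA ler_pdivrMr ?mulr_gt0 // mul1r.
move: eE ey; rewrite -[m.+2%:R]natr1; move: (m.+1%:R : R) => M eE ey.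
have : e * (M * (e - y)) <= e * 1 by rewrite ler_pM2l.
nra.
Qed.

Lemma cconv_cvg : cconv 0 m @[m --> \oo] --> x.
Proof.
apply: (@squeeze_cvgr _ _ _ _ (fun=> x) (fun m => x + harmonic m)).
- apply: nearW => m; have [+ +] := cconv_dist 0 m; rewrite /= => d0 d1.
  rewrite -subr_ge0 d0 /= -lerBlDl.
  by rewrite -(ler_pM2l (ltr0Sn R m)) mulfV // pnatr_eq0.
- exact: cvg_cst.
- by rewrite -[X in _ --> X]addr0; apply: cvgD; [exact: cvg_cst|exact: cvg_harmonic].
Qed.

End HirzebruchExpansion.

Lemma qreal_exists {R : realType} (x : R) : exists A, is_qreal x A.
Proof.
have [[r _ rE]|x_irr] := pselect (rational x).
  have d0 : (0 < `|denq r|)%N by rewrite absz_gt0 denq_eq0.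
  have [a [s [s2 xE _]]] := hcf_rational (R := R) (numq r) d0.
  exists (serA a s); left; split; first by exists r.
  exists a, s; split=> //; last exact: serA_expansion.
  rewrite -xE -rE /ratr; congr (_ / _).
  by rewrite -[in LHS](@gez0_abs (denq r)).
pose a := cdigit x; pose B k := serA (a 0) (digits a k).
have a2 i : 2 <= a i.+1 by exact: cdigitS_ge2.
have d2 k : all (fun b : int => 2 <= b) (digits a k).
  by apply/allP => _ /mapP[i _ ->].
pose K (n : int) := `|n + (`|a 0|.+1)%:Z|.+1.
have stab n k : (K n <= k)%N -> B k n = B (K n) n.
  move=> Kk; have dE : digits a k = digits a (K n) ++
      map (fun i => a i.+1) (iota (K n) (k - K n)).
    by rewrite /digits /mkseq -map_cat -iotaD subnKC.
  rewrite /B dE; apply/esym/serA_stable; first by rewrite -dE.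
  by rewrite size_mkseq /K; lia.
have Ab : exists m : int, forall n, n < m -> B (K n) n = 0.
  exists (- (`|a 0|.+1)%:Z) => n nm; rewrite /= /serz.
  by case E : (n + _) => //; lia.
exists (Laurent Ab); right; split=> //; exists a, B; split=> //.
- have -> : (fun k => hcf (a 0) (digits a k) : R) = cconv x 0.
    by apply/funext => k; rewrite -cconvE.
  exact: cconv_cvg.
- by move=> k; exact: serA_expansion.
- by move=> n; exists (K n) => // k /= /stab.
Qed.

(* [x]_q; by [qreal_exists] the choice below is never vacuous, and it is
   canonical because the negative continued fraction expansion of [x] and the
   Laurent expansion of a rational function are unique. *)
Definition qreal {R : realType} (x : R) : laurent := sval (cid (qreal_exists x)).

(* Main.v *)
Require Import Defs.
From mathcomp Require Import all_boot all_order all_algebra.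
From mathcomp Require Import all_classical all_reals topology normedtype.
From mathcomp Require Import zify ring lra.

(** The golden trees satisfy [D = 1 + (q + q^2) D + q^3 D^2], which after
    [q -> -q] is the equation for [([phi]_q - 1) / q^2], [phi] the golden ratio.
    It suffices to show that for [1 < x < 2] the coefficients of
    [G = ([x]_q - 1) / q^2] are bounded in absolute value by those of [D].
    Grouping the initial run of 2s in the tail of [x = [[2, 2, ..., 2, b, ...]]]
    gives [G = q^k U / (1 + q [k+1]_q U)] with [U = [m]_q + q^(m+1) K], [m >= 1],
    where [K] is zero or the series [G] of a shorter tail, so that [K] obeys the
    bound by induction.  The bound is then carried from [K] to [G] coefficient
    by coefficient, through the recurrence obtained by clearing denominators;
    except for [k = 0, m = 1], where it reproduces the golden equation, one
    multiplies by [1 - q] first. *)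

Import Order.TTheory GRing.Theory Num.Theory.
Local Open Scope ring_scope.

(** * Golden trees: counting inequalities and the choice of signs *)

Definition golden_num n : nat := #|{: golden_deg n}|.

Lemma deg_E : deg E == 0%N. Proof. by []. Qed.

Lemma golden_num0_gt0 : (0 < golden_num 0)%N.
Proof. by apply/card_gt0P; exists (exist _ E deg_E). Qed.

Section Constructors.
Variable n : nat.

Lemma deg_P1_sub (T : golden_deg n) : deg (P1 (sval T)) == n.+1.
Proof. by rewrite /= (eqP (svalP T)). Qed.

Lemma deg_P2_sub (T : golden_deg n) : deg (P2 (sval T)) == n.+2.
Proof. by rewrite /= (eqP (svalP T)). Qed.

Lemma deg_Q_sub (i : 'I_n.+1) (T : golden_deg i * golden_deg (n - i)) :
  deg (Q (sval T.1) (sval T.2)) == n.+3.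
Proof.
by rewrite /= (eqP (svalP T.1)) (eqP (svalP T.2)) -addnA subnKC // -ltnS.
Qed.
End Constructors.

(** The coefficient of [q^n] in the square of the generating series of golden trees. *)
Definition golden_pairs n : nat := \sum_(i < n.+1) golden_num i * golden_num (n - i).

Lemma golden_num_le1 n : (golden_num n <= golden_num n.+1)%N.
Proof.
pose f (T : golden_deg n) : golden_deg n.+1 := exist _ (P1 (sval T)) (deg_P1_sub n T).
by apply: (@leq_card _ _ f) => T T' [] /val_inj.
Qed.

Lemma golden_num_le2 n : (golden_num n.+1 + golden_num n <= golden_num n.+2)%N.
Proof.
pose f (T : golden_deg n.+1 + golden_deg n) : golden_deg n.+2 :=
  match T with
  | inl T1 => exist _ (P1 (sval T1)) (deg_P1_sub n.+1 T1)
  | inr T2 => exist _ (P2 (sval T2)) (deg_P2_sub n T2)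
  end.
by rewrite -card_sum; apply: (@leq_card _ _ f) => -[T|T] [T'|T'] [] // /val_inj->.
Qed.

Lemma golden_num_le3 n :
  (golden_num n.+2 + golden_num n.+1 + golden_pairs n
    <= golden_num n.+3)%N.
Proof.
pose S := {i : 'I_n.+1 & (golden_deg i * golden_deg (n - i))%type}.
pose f (T : golden_deg n.+2 + golden_deg n.+1 + S) : golden_deg n.+3 :=
  match T with
  | inl (inl T1) => exist _ (P1 (sval T1)) (deg_P1_sub n.+2 T1)
  | inl (inr T2) => exist _ (P2 (sval T2)) (deg_P2_sub n.+1 T2)
  | inr (existT i T12) => exist _ (Q (sval T12.1) (sval T12.2)) (deg_Q_sub n i T12)
  end.
have -> : golden_pairs n = #|{: S}|.
  rewrite card_tagged sumnE big_map big_enum /=.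
  by apply: eq_bigr => i _; rewrite card_prod.
rewrite -!card_sum; apply: (@leq_card _ _ f).
move=> [[T|T]|[i [T1 T2]]] [[T'|T']|[i' [T1' T2']]] //=.
- by case=> /val_inj->.
- by case=> /val_inj->.
- case=> E1 E2.
  have ii' : i = i'.
    by apply: ord_inj; rewrite -(eqP (svalP T1)) -(eqP (svalP T1')) E1.
  case: i' / ii' T1' T2' E1 E2 => T1' T2' E1 E2.
  by rewrite (val_inj E1) (val_inj E2).
Qed.

(* Raises degrees by one, except at [E]; its image misses that of [P1]. *)
Definition grow (T : golden) : golden :=
  match T with
  | E => E
  | P1 T1 => P2 T1
  | P2 T1 => Q E T1
  | Q T1 T2 => Q (P1 T1) T2
  end.

(** [P1] and [grow] have disjoint images once [E] is excluded. This growth pays for the extra terms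
    created by multiplying with [1 - q]. *)
Lemma golden_num_double n : ((golden_num n.+1).*2 <= golden_num n.+2)%N.
Proof.
have deg_grow (T : golden_deg n.+1) : deg (grow (sval T)) == n.+2.
  by case: T => -[|T|T|T T'] /= dT //; lia.
pose f (T : golden_deg n.+1 + golden_deg n.+1) : golden_deg n.+2 :=
  match T with
  | inl T1 => exist _ (P1 (sval T1)) (deg_P1_sub n.+1 T1)
  | inr T2 => exist _ (grow (sval T2)) (deg_grow T2)
  end.
rewrite -addnn -card_sum; apply: (@leq_card _ _ f).
case=> -[T TP] [] [T' TP'] //= [].
- by move=> TT'; congr inl; apply: val_inj.
- by case: T' TP'.
- by case: T TP.
- move=> TT'; congr inr; apply: val_inj => /=.
  by case: T T' TP TP' TT' => [|T|T|T1 T2] [|T'|T'|T1' T2'] //= _ _ [] => *; subst.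
Qed.

Lemma golden_num_homo : {homo golden_num : m n / (m <= n)%N}.
Proof. by apply: homo_leq => //; [exact: leq_trans|exact: golden_num_le1]. Qed.

Lemma golden_num_gt0 n : (0 < golden_num n)%N.
Proof. exact: leq_trans golden_num0_gt0 (golden_num_homo _ _ (leq0n n)). Qed.

Lemma golden_pairs_homo : {homo golden_pairs : m n / (m <= n)%N}.
Proof.
apply: homo_leq => //; first exact: leq_trans.
move=> n; rewrite /golden_pairs [leqRHS]big_ord_recr /= -[leqLHS]addn0 leq_add //.
apply: leq_sum => i _; rewrite leq_mul2l subSn ?golden_num_le1 ?orbT //.
by rewrite -ltnS.
Qed.

Lemma golden_num_sum n : (\sum_(i < n.+1) golden_num i <= golden_num n.+1)%N.
Proof.
elim: n => [|n IHn]; first by rewrite big_ord1 golden_num_le1.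
by rewrite big_ord_recr; apply: leq_trans (golden_num_double n); rewrite -addnn leq_add2r.
Qed.

(** The sign of [a] is given to [|a|] elements of [T], zero to the others. The theorem thus becomes
    a bound on coefficients. *)
Lemma signed_sum (T : finType) (a : int) : `|a| <= #|T|%:Z ->
  exists eps : T -> int,
    (forall t, eps t \in [:: 0; 1; -1]) /\ a = \sum_t eps t.
Proof.
move=> aT; pose S := [set t in take `|a|%N (enum T)].
exists (fun t => if t \in S then sgz a else 0).
split=> [t|]; first by case: ifP => // _; rewrite !inE; case: (sgzP a).
rewrite -big_mkcond sumr_const.
have -> : #|S| = `|a|%N.
  rewrite cardsE (card_uniqP (take_uniq _ (enum_uniq T))) size_take -cardT.
  by move: aT; rewrite cardE; set u := size _; case: ltnP; lia.
by rewrite -mulr_natr natz -intEsg.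
Qed.

(** * Shifted sequences and coefficientwise majorization *)

Definition shift t (f : nat -> nat) n : nat := if (n < t)%N then 0 else f (n - t)%N.

Lemma shift_anti f s t n : {homo f : m n / (m <= n)%N} -> (s <= t)%N ->
  (shift t f n <= shift s f n)%N.
Proof.
rewrite /shift => f_homo st; case: ltnP => // tn; case: ltnP => sn; first by lia.
by apply: f_homo; lia.
Qed.

(** The golden recurrence multiplied by [q^t], read as an inequality of coefficients. *)
Lemma shift_rec t n :
  ((n == t) + shift t.+1 golden_num n + shift t.+2 golden_num n
    + shift t.+3 golden_pairs n <= shift t golden_num n)%N.
Proof.
rewrite /shift; have [nt|/subnKC <-] := ltnP n t.
  by rewrite !ifT; lia.
move: (n - t)%N => {}n; rewrite -[X in _ == X]addn0 eqn_add2l.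
rewrite -[t.+3]addn3 -[t.+2]addn2 -[t.+1]addn1 !ltn_add2l !subnDl addKn.
case: n => [|[|[|n]]] /=.
- exact: golden_num_gt0.
- by rewrite add0n !addn0 golden_num_le1.
- by rewrite !subSS !subn0 add0n addn0 golden_num_le2.
- by have := golden_num_le3 n; rewrite !subSS !subn0 add0n.
Qed.

Definition majorized n (A : {poly int}) (f : nat -> nat) :=
  forall i, (i < n)%N -> `|A`_i| <= (f i)%:Z.

Lemma majorized_mul n A B f g : majorized n A f -> majorized n B g ->
  majorized n (A * B) (fun j => (\sum_(i < j.+1) f i * g (j - i))%N).
Proof.
move=> Af Bg j jn; rewrite coefM; apply: le_trans (ler_norm_sum _ _ _) _.
rewrite -natz natr_sum; apply: ler_sum => i _.
rewrite normrM natrM !natz; apply: ler_pM => //; [apply: Af|apply: Bg];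
  by have := ltn_ord i; lia.
Qed.

Lemma majorized_XnM t n A f : majorized n A f -> majorized (n + t) ('X^t * A) (shift t f).
Proof.
move=> Af i int; rewrite coefXnM /shift; case: ltnP => ti; first by rewrite normr0.
by apply: Af; lia.
Qed.

Lemma majorized_le m n A f : (m <= n)%N -> majorized n A f -> majorized m A f.
Proof. by move=> mn Af i im; apply: Af; apply: leq_trans mn. Qed.

(** * q-integers and the quotient form *)

Definition qbracket m : {poly int} := \poly_(i < m) 1.

Lemma qbracketS m : qbracket m.+1 = 1 + 'X * qbracket m.
Proof.
by apply/polyP => -[|i]; rewrite coefD coefXM !coef_poly coef1 /= ?addr0 ?add0r.
Qed.

Lemma qbracketSr m : qbracket m.+1 = qbracket m + 'X^m.
Proof. by rewrite /qbracket !poly_def big_ord_recr /= scale1r. Qed.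

Lemma qbracket0 : qbracket 0 = 0.
Proof. by rewrite /qbracket poly_def big_ord0. Qed.

Lemma qbracket_geom m : (1 - 'X) * qbracket m = 1 - 'X^m.
Proof.
elim: m => [|m IHm].
  by rewrite qbracket0 mulr0 expr0 subrr.
by rewrite qbracketS mulrDr mulrCA IHm exprS; ring.
Qed.

(* For [k = 0] the quotient ['X^k * qU m K / qV k m K] is [[w]_q / (1 + q [w]_q)],
   where [[w]_q = qU m K]; each further leading 2 maps a quotient [G] to
   [q G / (1 + q^2 G)]. *)
Definition qU m (K : {poly int}) : {poly int} := qbracket m + 'X^(m.+1) * K.
Definition qV k m K : {poly int} := 1 + 'X * qbracket k.+1 * qU m K.

Lemma qU_geom m K :
  (1 - 'X) * qU m K = 1 - 'X^m + 'X^(m.+1) * K - 'X^(m.+2) * K.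
Proof. by rewrite /qU mulrDr qbracket_geom !exprS; ring. Qed.

Lemma qV_geom k m K : (1 - 'X) * qV k m.+1 K =
  1 + 'X^2 * (qbracket m - 'X^k * qbracket m.+1) + 'X^(m.+3) * K - 'X^(k + m.+4) * K.
Proof.
rewrite /qV mulrDr mulr1 -mulrA mulrCA [_ * (_ * qU _ _)]mulrA qbracket_geom.
rewrite mulrBl mul1r mulrBr {1}/qU {1}qbracketS /qU exprD !exprS; ring.
Qed.

(** * Carrying the bound through the quotient *)

(** For the generating series [D] of golden trees: [q + q^2 D / (1 - q) <= q D]. *)
Lemma shift_sum_le n :
  (shift 2 (fun j => \sum_(i < j.+1) 1 * golden_num (j - i)) n + (n == 1)
    <= shift 1 golden_num n)%N.
Proof.
case: n => [|[|n]] //; first exact: golden_num_gt0.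
rewrite /shift !subSS !subn0 addn0; apply: leq_trans (golden_num_sum n).
rewrite (reindex_inj rev_ord_inj); apply: leq_sum => i _ /=.
by rewrite mul1n subSS subKn // -ltnS.
Qed.

Lemma shift_le2 k n : (0 < k)%N ->
  ((n == k) + shift k.+1 golden_num n + shift k.+2 golden_num n
    <= shift 1 golden_num n + shift 2 golden_num n)%N.
Proof.
move=> k0; have [->|nk] := eqVneq n k.
  rewrite /shift !ltnS leqnn leqnSn [(k <= 0)%N]leqNgt k0 /=.
  by have := golden_num_gt0 (k - 1); lia.
by rewrite add0n [leqRHS]addnC leq_add // shift_anti //; exact: golden_num_homo.
Qed.

(** In series, [q^k + q^(k+m+1) D + q^(m+3) D^2 + q D <= D + q]. The last [q] makes up for the
    failure of doubling from degree 0 to degree 1. *)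
Lemma shift_double k m n : (0 < m)%N ->
  ((n == k) + shift (k + m.+1) golden_num n + shift (m.+3) golden_pairs n
    + shift 1 golden_num n <= golden_num n + (n == 1))%N.
Proof.
move=> m0.
have r1 := shift_rec 1%N n.
have c4 : (shift m.+3 golden_pairs n <= shift 4 golden_pairs n)%N.
  by apply: shift_anti => //; exact: golden_pairs_homo.
have d2 : (shift (k + m.+1) golden_num n <= shift 2 golden_num n)%N.
  by apply: shift_anti; [exact: golden_num_homo|lia].
case: n r1 c4 d2 => [|[|n]].
- by rewrite /shift !addn0; case: k => //= *; exact: golden_num0_gt0.
- have := golden_num_le1 0; rewrite /shift /= !subSS !subn0.
  by lia.
have d2n := golden_num_double n; have dn0 := golden_num_gt0 n; rewrite -addnn in d2n.
have -> : shift 1 golden_num n.+2 = golden_num n.+1 by rewrite /shift /= subSS subn0.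
have -> : shift 2 golden_num n.+2 = golden_num n by rewrite /shift /= !subSS subn0.
case: (eqVneq n.+2 k) => [<-|_]; last by lia.
have -> : shift (n.+2 + m.+1) golden_num n.+2 = 0%N by rewrite /shift ifT //; lia.
by lia.
Qed.

(** Strong induction on the coefficient: on the right of each recurrence [G] stands behind a
    positive power of [q]. *)
Lemma majorized_quotient M k m K G : (0 < m)%N -> majorized M K golden_num ->
  congX M (G * qV k m K) ('X^k * qU m K) -> majorized M G golden_num.
Proof.
(* From here on [m] is one less than in the statement. *)
case: m => // m _ Kd GVU; elim/ltn_ind => n IHn nM.
have Gd : majorized n G golden_num.
  by move=> i ni; apply: IHn => //; apply: ltn_trans nM.
have KGc : majorized n (K * G) golden_pairs.
  by apply: majorized_mul => //; apply: majorized_le Kd; apply: ltnW.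
have Kd' : majorized n K golden_num by apply: majorized_le Kd; apply: ltnW.
have maj_term t A f : majorized n A f -> (0 < t)%N ->
    `|('X^t * A)`_n| <= (shift t f n)%:Z.
  by move=> Af t0; apply: (majorized_XnM _ _ _ _ Af); lia.
have [km|km] := boolP ((k == 0) && (m == 0))%N.
  case/andP: km GVU => /eqP-> /eqP->; rewrite expr0 mul1r /qV /qU.
  rewrite !qbracketS qbracket0 => -[C E].
  have {E}E : G = 1 + 'X^2 * K - 'X^1 * G - 'X^3 * (K * G) + 'X^M * C.
    have E' : G = G * (1 + 'X * (1 + 'X * 0) * (1 + 'X * 0 + 'X^2 * K))
        - 'X^1 * G - 'X^3 * (K * G) by ring.
    by rewrite {1}E' E; ring.
  rewrite E !(coefB, coefD) [('X^M * C)`_n]coefXnM nM coef1 addr0 natz.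
  have := shift_rec 0%N n; rewrite {4}/shift ltn0 subn0.
  have := maj_term 2%N _ _ Kd' isT; have := maj_term 1%N _ _ Gd isT.
  have := maj_term 3%N _ _ KGc isT.
  move: ((n == 0)%N : nat) => b.
  move: (('X^3 * (K * G))`_n) (('X^1 * G)`_n) (('X^2 * K)`_n) => x y z.
  by lia.
(* The defining relation of [G] multiplied by [1 - 'X]. *)
have {GVU}E : exists C, G = 'X^k - 'X^(k + m.+1)
    + 'X^(k + m.+2) * K - 'X^(k + m.+3) * K
    - 'X^2 * ((qbracket m - 'X^k * qbracket m.+1) * G)
    - 'X^(m.+3) * (K * G) + 'X^(k + m.+4) * (K * G) + 'X^M * C.
  case: GVU => C E; exists ((1 - 'X) * C).
  pose W := 'X^2 * (qbracket m - 'X^k * qbracket m.+1) + 'X^(m.+3) * K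
    - 'X^(k + m.+4) * K.
  have EG : G = (1 - 'X) * (G * qV k m.+1 K) - G * W.
    by rewrite mulrCA qV_geom /W; ring.
  rewrite {1}EG E mulrDr [_ * ('X^k * _)]mulrCA qU_geom /W !exprD !exprS; ring.
case: E => C ->; rewrite !(coefB, coefD) [('X^M * C)`_n]coefXnM nM !coefXn addr0 !natz.
have K1 := maj_term (k + m.+2)%N _ _ Kd' ltac:(lia).
have K2 := maj_term (k + m.+3)%N _ _ Kd' ltac:(lia).
have KG1 := maj_term (m.+3)%N _ _ KGc ltac:(lia).
have KG2 := maj_term (k + m.+4)%N _ _ KGc ltac:(lia).
have := shift_rec (k + m.+1)%N n; rewrite -!addnS => rk.
have r0 := shift_rec 0%N n; rewrite {4}/shift ltn0 subn0 in r0.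
have r1 := shift_rec 1%N n.
have [m0|m_gt0] := posnP m.
  (* [rk] collects all but [q^k], the [G] term and [q^3 K G] into [q^(k+1) D]; [shift_le2] reduces
     the rest to [q D + q^2 D], and [r0] concludes. *)
  have k0 : (0 < k)%N by rewrite m0 eqxx andbT in km; rewrite lt0n.
  have := maj_term k.+2 _ _ Gd isT; have := shift_le2 _ n k0.
  have -> : 'X^2 * ((qbracket m - 'X^k * qbracket m.+1) * G) = - ('X^(k.+2) * G).
    by rewrite m0 qbracketS qbracket0 !exprS; ring.
  move: K1 K2 KG1 KG2 rk r0; rewrite m0 coefN !addnS addn0.
  move: (('X^(k.+2) * K)`_n) (('X^(k.+3) * K)`_n) (('X^3 * (K * G))`_n)
    (('X^(k.+4) * (K * G))`_n) (('X^(k.+2) * G)`_n) => x y z t u.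
  move: (n == k : nat) (n == k.+1 : nat) => b b'.
  by lia.
(* Both brackets have coefficients 0 or 1, so the product with [G] is bounded by partial sums of
   [golden_num]. *)
have Zmaj : majorized n (qbracket m - 'X^k * qbracket m.+1) (fun=> 1%N).
  move=> i _; rewrite coefB coefXnM !coef_poly.
  by do 3?case: ifP => _; rewrite ?subr0 ?sub0r ?subrr ?normrN1 ?normr1 ?normr0.
have := maj_term 2%N _ _ (majorized_mul _ _ _ _ _ Zmaj Gd) isT.
(* [rk] absorbs [q^(k+m+1)], both [K] terms and the higher [K G] term into [q^(k+m+1) D];
   [shift_sum_le] trades the [G] term for [q D - q], and [shift_double] bounds the total by [D]. *)
have := shift_sum_le n; have := shift_double k m n m_gt0.
move: K1 K2 KG1 KG2 rk.
set x1 := ('X^(k + m.+2) * K)`_n; set x2 := ('X^(k + m.+3) * K)`_n.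
set x3 := ('X^(m.+3) * (K * G))`_n; set x4 := ('X^(k + m.+4) * (K * G))`_n.
set x5 := ('X^2 * ((qbracket m - 'X^k * qbracket m.+1) * G))`_n.
move: x1 x2 x3 x4 x5 => x1 x2 x3 x4 x5.
move: (n == k : nat) (n == (k + m.+1)%N : nat) => b b'.
by lia.
Qed.

(** * Shape of the continued fraction *)

(** If the tail of [x] has q-real [P / D], then [[x]_q = 1 + q (P - D) / P], so [G] is [([x]_q - 1)
    / q^2]. The factor [C] cancels, and [qV] is invertible because its constant term is 1. *)
Lemma shape_quotient M k m (K C P D : {poly int}) :
    (0 < m)%N -> majorized M K golden_num ->
    congX M P (C * qV k m K) -> congX M (P - D) (C * 'X^(k.+1) * qU m K) ->
  exists2 G, majorized M G golden_num & congX M (P - D) ('X * P * G).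
Proof.
move=> m0 Kd [C1 EP] [C2 EPD].
have V0 : (qV k m K)`_0 = 1 by rewrite /qV coefD coef1 -mulrA coefXM addr0.
have [C3 EW] := congX_le (leqnSn M) (uinvP M V0); set W := uinv _ _ in EW.
exists ('X^k * qU m K * W).
  apply: (@majorized_quotient M k m K) => //; exists ('X^k * qU m K * C3).
  by rewrite -mulrA [W * _]mulrC EW; ring.
exists (C2 - C * 'X^(k.+1) * qU m K * C3 - 'X^(k.+1) * C1 * qU m K * W).
rewrite EPD {1}EP.
transitivity (C * 'X^(k.+1) * qU m K * (qV k m K * W)
  + 'X^M * (C2 - C * 'X^(k.+1) * qU m K * C3)); first by rewrite EW; ring.
by rewrite !exprS; ring.
Qed.

(* [k] counts the leading entries 2 before the entry that determines [m]. *)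
Lemma pd_shape M b s : all (fun b : int => 2 <= b) (b :: s) ->
  exists k m K C, [/\ (0 < m)%N, majorized M K golden_num,
    congX M (pd (b :: s)).1 (C * qV k m K)
  & congX M ((pd (b :: s)).1 - (pd (b :: s)).2) (C * 'X^(k.+1) * qU m K)].
Proof.
elim: s b => [|b' s IHs] b.
  case/andP=> b2 _; exists 0%N, `|b|.-1, 0, 1; rewrite pdE /=.
  have [m ->] : exists m, `|b|%N = m.+2 by exists `|b|.-2; lia.
  rewrite -/(qbracket m.+2) /qV /qU qbracketS.
  split=> //; first by move=> i _; rewrite coef0 normr0.
  - by exists 0; rewrite [qbracket 1]qbracketS qbracket0; ring.
  - by exists 0; ring.
case/andP=> b2 /IHs[k [m [K [C [m0 Kd]]]]].
rewrite [pd [:: b, b' & s]]pdE; case: (pd (b' :: s)) => P D /= [C1 EP] [C2 EPD].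
have [n bn] : exists n, `|b|%N = n.+2 by exists `|b|.-2; lia.
rewrite bn /= -/(qbracket n.+2) qbracketSr.
have EP' : (qbracket n.+1 + 'X^(n.+1)) * P - 'X^(n.+1) * D =
    qbracket n.+1 * P + 'X^(n.+1) * (P - D).
  by ring.
(* If [b >= 3], the series [G] of the tail becomes the new [K], with [C = P] and [k = 0]. If
   [b = 2], only [k] grows. *)
case: n {bn} EP' => [|n] EP'; last first.
  have [||||G Gd [C3 EG]] := @shape_quotient M k m K C P D => //;
    [by exists C1|by exists C2|].
  exists 0%N, n.+1, G, P; split=> //; rewrite EP' EG.
  - exists ('X^(n.+2) * C3); rewrite /qV /qU [qbracket 1]qbracketS qbracket0.
    by rewrite [qbracket n.+2]qbracketS !exprS; ring.
  - by exists ('X^(n.+2) * C3); rewrite /qU [qbracket n.+2]qbracketS !exprS; ring.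
exists k.+1, m, K, C; split=> //; rewrite EP' EPD.
- exists (C1 + 'X * C2); rewrite [qbracket 1]qbracketS qbracket0 EP /qV.
  by rewrite [qbracket k.+2]qbracketSr !exprS; ring.
- by exists ('X * C2); rewrite [qbracket 1]qbracketS qbracket0 !exprS; ring.
Qed.

(** [H] is [[x]_q - 1] modulo [q^M] for [x = [[2, s]]]; the empty tail gives [x = 2] and [H = q]. *)
Lemma pd_series M s : all (fun b : int => 2 <= b) s ->
  exists2 H : {poly int}, congX M ('X * ((pd s).1 - (pd s).2)) ((pd s).1 * H)
  & forall n, (2 <= n)%N -> (n < M)%N -> `|H`_n| <= (golden_num (n - 2))%:Z.
Proof.
case: s => [_|b s s2].
  exists 'X; first by exists 0; rewrite /pd /=; ring.
  by move=> [|[|n]] // _ _; rewrite coefX normr0.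
have [k [m [K [C [m0 Kd EP EPD]]]]] := pd_shape M _ _ s2.
have [G Gd [C' EG]] := shape_quotient _ _ _ _ _ _ _ m0 Kd EP EPD.
exists ('X^2 * G); first by exists ('X * C'); rewrite EG; ring.
by move=> n n2 nM; rewrite coefXnM ltnNge n2; apply: Gd; lia.
Qed.

(** * Comparison with Laurent expansions *)

Lemma congX_of_coef M (A B : {poly int}) :
  (forall n, (n < M)%N -> A`_n = B`_n) -> congX M A B.
Proof.
move=> AB; exists (drop_poly M (A - B)).
have := poly_take_drop M (A - B).
have -> : take_poly M (A - B) = 0.
  apply/polyP => i; rewrite coef_take_poly coef0; case: ifP => // iM.
  by rewrite coefB AB ?subrr.
by rewrite add0r mulrC => ->; ring.
Qed.

Lemma coef_cancel (D B : {poly int}) M : D`_0 != 0 ->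
  (forall n, (n < M)%N -> (D * B)`_n = 0) -> forall n, (n < M)%N -> B`_n = 0.
Proof.
move=> D0 DB; elim/ltn_ind => n IHn nM; have := DB n nM.
rewrite coefM big_ord_recl subn0 big1 => [|i _]; last first.
  by rewrite lift0 IHn ?mulr0 //; have := ltn_ord i; lia.
by move/eqP; rewrite addr0 mulf_eq0 (negPf D0) => /eqP.
Qed.

(** [D] may vanish at 0; its order of vanishing [v] is the precision lost in cancelling it. *)
Lemma congX_cancel (D : {poly int}) : D != 0 -> exists v, forall B M,
  congX (v + M) (D * B) 0 -> forall n, (n < M)%N -> B`_n = 0.
Proof.
move=> Dn0; have [v [D' + DE]] := multiplicity_XsubC D 0.
rewrite Dn0 subr0 in DE * => /= D'0; exists v => B M [C]; rewrite add0r exprD => E.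
apply: (@coef_cancel D'); first by rewrite -horner_coef0.
have {}E : D' * B = 'X^M * C.
  apply: (@mulfI _ 'X^v); first by rewrite expf_neq0 ?polyX_eq0.
  by rewrite !mulrA -E DE; ring.
by move=> n nM; rewrite E coefXnM nM.
Qed.

(** Multiplying by [q^b] clears the negative powers in [A]. *)
Lemma laurent_truncation (Nm Dn : {poly int}) (A : laurent) b L :
  (forall n : int, n < - b%:Z -> A n = 0) ->
  (forall n : int, \sum_(j < size Dn) Dn`_j * A (n - j%:Z) = coefz Nm n) ->
  congX L (Dn * \poly_(i < L) A (i%:Z - b%:Z)) ('X^b * Nm).
Proof.
move=> Ab DA; apply: congX_of_coef => n nL.
have -> : ('X^b * Nm)`_n = coefz Nm (n%:Z - b%:Z).
  rewrite coefXnM; case: ltnP => nb.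
    by case E: (n%:Z - b%:Z) => [k|k] //; exfalso; lia.
  by rewrite subzn.
rewrite -DA.
rewrite (@sum_size_widen _ (fun j => A (n%:Z - b%:Z - j%:Z)) (size Dn + n.+1))
  ?leq_addr //.
rewrite coefM (big_ord_widen _
  (fun j => Dn`_j * (\poly_(i < L) A (i%:Z - b%:Z))`_(n - j)%N)
  (leq_addl (size Dn) n.+1)) big_mkcond.
apply: eq_bigr => j _; rewrite ltnS coef_poly.
case: (leqP j n) => jn; last by rewrite Ab ?mulr0 //; lia.
have -> : (n - j < L)%N by apply: leq_ltn_trans nL; exact: leq_subr.
by congr (_ * A _); rewrite -subzn //; ring.
Qed.

(** The expansion may come from any fraction [Nm / Dn] equal to [q_hcf 2 s]; cross-multiplication
    compares it with the one from [pd]. *)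
Lemma qreal_coef_le s (A : laurent) N : all (fun b : int => 2 <= b) s ->
  laurent_expansion (q_hcf 2 s) A -> (2 <= N)%N ->
  `|A N%:Z| <= (golden_num (N - 2))%:Z.
Proof.
move=> s2 [Nm [Dn [Dn0 FE DA]]] N2.
have [b Ab] : exists b : nat, forall n : int, n < - b%:Z -> A n = 0.
  by have [m Am] := laurent_bounded A; exists `|m|%N => n nm; apply: Am; lia.
have P0 := pd_coef0 s2; have Pn0 := pd_neq0 s2.
have [H [C1 HE] Hd] := pd_series (N + b).+1 _ s2.
have cross : Nm * (pd s).1 = ((pd s).1 + 'X * ((pd s).1 - (pd s).2)) * Dn.
  have s2' : all (fun b : int => 2 <= b) (2 :: s) by [].
  have := q_hcf_pd s2'; rewrite FE pdE /= => /eqP.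
  rewrite eqr_div ?tofrac_eq0 // -!tofracM tofrac_eq => /eqP->.
  by rewrite -/(qbracket 2) !qbracketS qbracket0; ring.
have [v cancel] := congX_cancel _ Dn0.
(* After [Dn] is cancelled, precision remains up to coefficient [N + b], which is coefficient [N] of
   [A]. *)
have [C EB] := laurent_truncation _ _ _ b (v + (N + b).+1)%N Ab DA.
set B := \poly_(i < _) _ in EB.
have PB n : (n < (N + b).+1)%N ->
    ((pd s).1 * B - 'X^b * ((pd s).1 + 'X * ((pd s).1 - (pd s).2)))`_n = 0.
  apply: cancel; exists ((pd s).1 * C).
  transitivity ((pd s).1 * (Dn * B) - 'X^b * (Nm * (pd s).1)).
    by rewrite cross; ring.
  by rewrite EB; ring.
have : (B - 'X^b * (1 + H))`_(N + b) = 0.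
  apply: (@coef_cancel (pd s).1 _ (N + b).+1) => //; first by rewrite P0.
  move=> n nM; rewrite -[RHS](PB n nM); apply: congX_coef nM.
  by exists ('X^b * C1); rewrite HE; ring.
move/eqP; rewrite coefB subr_eq0 coefXnM coefD coef1 coef_poly.
rewrite ifT; last by lia.
rewrite ifF; last by lia.
rewrite addnK gtn_eqF ?(leq_trans _ N2) // add0r PoszD addrK => /eqP->.
by apply: Hd => //; lia.
Qed.

(** * First digit and conclusion *)

Lemma hcf_itv (R : realType) (a : int) (s : seq int) :
  all (fun b : int => 2 <= b) s -> a%:~R - 1 < (hcf a s : R) <= a%:~R.
Proof.
elim: s a => [|b s IHs] a /=; first by rewrite lexx ltrBlDr ltrDl ltr01.
case/andP=> b2 /(IHs b)/andP[lb _].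
have h1 : 1 < (hcf b s : R).
  apply: le_lt_trans lb; rewrite lerBrDr -[1 + 1]/(2%:R) -[2%:R]/(2%:~R).
  by rewrite ler_int.
have h0 := lt_trans ltr01 h1.
by rewrite ltrD2l ltrN2 invf_lt1 // h1 gerBl invr_ge0 ltW.
Qed.

(** Both bounds on [x] by [a] are weak, so that they survive the limit of convergents. *)
Lemma qreal_first_digit (R : realType) (x : R) (a : int) :
  1 < x < 2 -> a%:~R - 1 <= x <= a%:~R -> a = 2.
Proof.
case/andP=> x1 x2 /andP[ax xa].
have : (1%:~R : R) < a%:~R by apply: lt_le_trans xa.
have : a%:~R < (3%:~R : R).
  by rewrite -[3%:~R]/(3 : R); lra.
by rewrite !ltr_int; lia.
Qed.

Theorem lemma4p8 (R : realType) (x : R) (N : nat)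
    (x12 : 1 < x < 2) (N2 : (2 <= N)%N) :
  exists eps : golden_deg (N - 2) -> int,
    (forall T : golden_deg (N - 2), eps T \in [:: 0; 1; -1]) /\
    qreal x N%:Z = \sum_(T : golden_deg (N - 2)) eps T.
Proof.
apply: signed_sum; rewrite /qreal; case: cid => A /=.
case=> [[_ [a [s [s2 xE Aexp]]]]|[_ [a [B [a2 cvg_x Bexp BA]]]]].
  have a2 : a = 2.
    apply: (qreal_first_digit _ x) => //.
    by have /andP[/ltW ? ?] := hcf_itv R a s s2; rewrite xE; apply/andP.
  by rewrite a2 in Aexp; apply: qreal_coef_le Aexp N2.
have d2 k : all (fun b : int => 2 <= b) (digits a k).
  by apply/allP => _ /mapP[i _ ->].
have a02 : a 0%N = 2.
  apply: (qreal_first_digit _ x) => //; apply/andP; split.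
  - apply: (cvgr_to_ge cvg_x); apply: nearW => k.
    by have /andP[/ltW] := hcf_itv R (a 0%N) _ (d2 k).
  - apply: (cvgr_to_le cvg_x); apply: nearW => k.
    by have /andP[] := hcf_itv R (a 0%N) _ (d2 k).
(* Coefficient [N] of the limit is already that of a convergent, whose first entry is 2. *)
have [K _ /(_ K (leqnn K)) /= <-] := BA N%:Z.
by have := Bexp K; rewrite a02 => /qreal_coef_le; apply.
Qed.
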